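(* Let $X$ be a (real) Hilbert space and let $T:X\to X$ be nonexpansive. Let $x_0\in X$, $y\in\mathrm{Fix}T$ and let $b\in\mathbb{N}$, $b\geq1$, with $\|x_0-y\|\leq b$. Let $F:X\to[0,+\infty]$ be given by $F(z):=\|z-Tz\|$ if $\|z-y\|\leq b$ and $F(z):=+\infty$ otherwise, and assume that $F$ has a modulus of regularity $\tau$ w.r.t. $\overline{B}_b(y)$. Let $\lambda:[0,+\infty)\to[0,1]$ be Lebesgue measurable and let $x$ be the unique strong global solution of \[ \dot x(t)=\lambda(t)\left(T(x(t))-x(t)\right),\qquad x(0)=x_0. \] Assume either: (1) $\int_0^{+\infty}\lambda(t)(1-\lambda(t))\,dt=+\infty$ with a divergence modulus $\eta:(0,\infty)\to\mathbb{N}$, i.e. $\int_0^r\lambda(t)(1-\lambda(t))\,dt\geq K$ for all $K>0$ and $r\geq\eta(K)$, where $\eta(K)\geq\eta(L)$ for $K\geq L$; in this case set $\varphi(\varepsilon):=\eta(b^2/\varepsilon^2)$; or (2) $\underline{\lambda}>0$ is such that $\lambda(t)\geq\underline{\lambda}$ for all $t\geq0$; in this case set $\varphi(\varepsilon):=4b^4/(\underline{\lambda}^2\varepsilon^2)$. Then, in either case, with $\rho(\varepsilon):=\varphi(\tau(\varepsilon)/2)+1$: \[ \forall\varepsilon>0\ \forall t\geq\rho(\varepsilon)\ (\mathrm{dist}(x(t),\mathrm{Fix}T)<\varepsilon)\quad\text{and}\quad\forall\varepsilon>0\ \forall s,t\geq\rho(\varepsilon/2)\ (\|x(t)-x(s)\|<\varepsilon).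 \] In particular, $x(t)$ converges to some fixed point $x^*$ of $T$ with that rate, i.e. $\|x(t)-x^*\|\leq\varepsilon$ for all $\varepsilon>0$ and $t\geq\rho(\varepsilon/2)$.
   Context: $\mathbb{N}$ contains $0$. $\mathrm{Fix}T$ is the set of fixed points of $T$, $\overline{B}_r(z)$ the closed ball of radius $r$ around $z$, and $\mathrm{zer}F:=\{z\in X\mid F(z)=0\}$ (so here $\mathrm{zer}F=\mathrm{Fix}T\cap\overline{B}_b(y)$). A modulus of regularity for $F$ w.r.t. $\overline{B}_b(y)$ is a function $\tau:(0,\infty)\to(0,\infty)$ such that for all $\varepsilon>0$ and all $u\in\overline{B}_b(y)$: $F(u)<\tau(\varepsilon)$ implies $\mathrm{dist}(u,\mathrm{zer}F)<\varepsilon$. A strong global solution is a function $x:[0,+\infty)\to X$ which is absolutely continuous on each interval $[0,a]$, $a\in(0,\infty)$, satisfies $x(0)=x_0$, and satisfies the differential equation almost everywhere on $[0,+\infty)$; under the stated assumptions it exists and is unique. *)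

(* Defs.v *)
From HB Require Import structures.
From mathcomp Require Import all_boot all_order all_algebra.
From mathcomp Require Import all_classical all_reals all_analysis.

Set Implicit Arguments.
Unset Strict Implicit.
Unset Printing Implicit Defensive.

Import Order.TTheory GRing.Theory Num.Theory.
Import numFieldNormedType.Exports.

Local Open Scope classical_set_scope.
Local Open Scope ring_scope.

(* A real Hilbert space is rendered as a [completeNormedModType] together with
   a symmetric positive definite bilinear form inducing its norm. *)
Definition induces_norm (R : realType) (X : completeNormedModType R)
    (ip : {dot X for (idfun : R -> R)}) : Prop :=
  forall u : X, `|u| ^+ 2 = ip u u.

Definition nonexpansive (R : realType) (X : normedModType R)
    (T : X -> X) : Prop :=
  forall u v : X, `|T u - T v| <= `|u - v|.

Definition Fix (X : Type) (T : X -> X) : set X := [set z | T z = z].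

Definition zer (R : realType) (X : Type) (F : X -> \bar R) : set X :=
  [set z | F z = 0%E].

Definition residual (R : realType) (X : normedModType R) (T : X -> X)
    (y : X) (b : R) (z : X) : \bar R :=
  if `|z - y| <= b then `|z - T z|%:E else +oo%E.

Definition modulus_of_regularity (R : realType) (X : normedModType R)
    (F : X -> \bar R) (y : X) (b : R) (tau : R -> R) : Prop :=
  (forall eps, 0 < eps -> 0 < tau eps) /\
  (forall eps u, 0 < eps -> closed_ball_ Num.norm y b u ->
     (F u < (tau eps)%:E)%E -> (edist_inf (zer F) u < eps%:E)%E).

Definition absolutely_continuous (R : realType) (X : normedModType R)
    (a b : R) (f : R -> X) : Prop :=
  forall eps, 0 < eps -> exists2 delta, 0 < delta &
    forall (n : nat) (l r : 'I_n -> R),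
      (forall i, [/\ a <= l i, l i < r i & r i <= b]) ->
      trivIset setT (fun i => `]l i, r i[%classic) ->
      \sum_(i < n) (r i - l i) < delta ->
      \sum_(i < n) `|f (r i) - f (l i)| < eps.

(* Functions on [0, +oo[ are total functions on [R] of which only the values
   on [0, +oo[ matter; at [t = 0], a null set, the two-sided derivative
   required below is irrelevant. *)
Definition strong_global_solution (R : realType) (X : normedModType R)
    (T : X -> X) (lambda : R -> R) (x0 : X) (x : R -> X) : Prop :=
  [/\ x 0 = x0,
      (forall a, 0 < a -> absolutely_continuous 0 a x) &
      {ae @lebesgue_measure R, forall t, 0 <= t ->
         is_derive (t : R^o) 1 (x : R^o -> X)
           (lambda t *: (T (x t) - x t))}].

(* [R] with the sigma-algebra of Lebesgue (rather than Borel) measurable sets,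
   i.e. the domain of [completed_lebesgue_measure]. *)
Definition lebesgueR (R : realType) := caratheodory_type
  ((wlength (idfun : R -> R))^*)%mu.

Definition lebesgue_measurable_fun (R : realType) (D : set R)
    (f : R -> R) : Prop :=
  measurable_fun (D : set (lebesgueR R)) (f : lebesgueR R -> R).

Definition divergence_modulus (R : realType) (g : R -> R)
    (eta : R -> nat) : Prop :=
  (forall K r : R, 0 < K -> (eta K)%:R <= r ->
     (K%:E <= \int[@completed_lebesgue_measure R]_(t in `[0%R, r]) (g t)%:E)%E)
  /\ (forall K L : R, 0 < L -> L <= K -> (eta L <= eta K)%N).

(* Main.v *)
Require Import Defs.
From HB Require Import structures.
From mathcomp Require Import all_boot all_order all_algebra.
From mathcomp Require Import all_classical all_reals all_analysis.
From mathcomp Require Import measurable_realfun ring lra.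

Set Implicit Arguments.
Unset Strict Implicit.
Unset Printing Implicit Defensive.

Import Order.TTheory GRing.Theory Num.Theory.
Import numFieldNormedType.Exports.
Local Open Scope classical_set_scope.
Local Open Scope ring_scope.

(** The flow x' = lambda (T x - x) inherits two monotonicities from the
    nonexpansiveness of T.  Up to o(h), x(t + h) is the convex combination
    (1 - h lambda) x(t) + h lambda T(x(t)); comparing it with a fixed point z
    shows that the distance from x to z cannot increase to first order, and
    splitting x(t + h) - T(x(t + h)) through T(x(t)) shows the same for the
    residual |x - T x|.  A first order bound that holds almost everywhere
    becomes genuine monotonicity because x is absolutely continuous
    ([absolutely_continuous_nonincreasing]).

    In a Hilbert space the first statement improves quantitatively: since
    |T x - y| <= |x - y|, expanding the square gives
      - d/dt |x - y|^2 = - 2 lambda <x - y, T x - x> >= lambda |x - T x|^2,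
    whence, integrating and using that the residual decreases,
      |x(a) - T(x(a))|^2 * int_0^a lambda <= |x0 - y|^2 <= b^2
    ([residual_energy]).  Both alternatives for phi say that int_0^a lambda is
    at least b^2 / eps^2 as soon as a >= phi(eps): in the first case because
    lambda (1 - lambda) <= lambda, in the second because lambda >= lambda_ and
    lambda_ <= 1 <= 4 b^2.  So the residual is at most eps from time phi(eps)
    on ([residual_rate]).

    With eps = tau(e) / 2 the modulus of regularity turns this into
    dist(x(t), Fix T) < e for t >= rho(e).  Monotonicity of the distance to
    fixed points then upgrades closeness at one time to closeness at all later
    times: a fixed point within e / 2 of x(rho(e / 2)) stays within e / 2 of
    the trajectory for ever, which is the Cauchy estimate; completeness
    provides the limit.

    The only delicate measure-theoretic step is the integration.  lambda is
    merely Lebesgue measurable, and instead of differentiating its indefinite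
    integral one applies Fatou's lemma to the difference quotients of the
    monotone function |x - y|^2 ([integral_le_decrease]). *)

(** * Borel functions under the completed Lebesgue measure *)

Section Completion.
Context {R : realType}.
Local Notation mu := (@lebesgue_measure R).
Local Notation nu := (@completed_lebesgue_measure R).

Lemma measurable_lebesgueR (A : set R) :
  measurable A -> measurable (A : set (lebesgueR R)).
Proof. by move=> mA; exact: sub_caratheodory. Qed.

Lemma measurable_fun_lebesgueR d (T : measurableType d) (D : set R)
    (f : R -> T) :
  measurable D -> measurable_fun D f ->
  measurable_fun (D : set (lebesgueR R)) f.
Proof. by move=> mD mf _ B mB; apply: measurable_lebesgueR; exact: mf. Qed.

Lemma measurable_itvcc_lebesgueR (a b : R) :
  measurable (`[a, b] : set (lebesgueR R)).
Proof. by apply: measurable_lebesgueR; exact: measurable_itv. Qed.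

Lemma lebesgue_measurable_fun_itv (a : R) (f : R -> R) :
  lebesgue_measurable_fun `[0, +oo[ f -> lebesgue_measurable_fun `[0, a] f.
Proof.
apply: measurable_funS.
  by apply: measurable_lebesgueR; exact: measurable_itv.
by move=> t; rewrite /= !in_itv/= => /andP[->].
Qed.

(** The two measures are the same outer measure on different sigma-algebras, so
    the Borel one is the image of the completed one under the identity. *)
Lemma ge0_integral_completed (D : set R) (f : R -> \bar R) :
  measurable D -> measurable_fun D f -> (forall t, D t -> (0 <= f t)%E) ->
  (\int[nu]_(t in D) f t = \int[mu]_(t in D) f t)%E.
Proof.
move=> mD mf f0.
have mid : measurable_fun [set: lebesgueR R]
    (id : lebesgueR R -> measurableTypeR R).
  by apply: measurable_fun_lebesgueR; [exact: measurableT|exact: measurable_id].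
have := ge0_integral_pushforward mid nu mD mf.
rewrite preimage_id => <-; last by move=> t /set_mem; exact: f0.
exact: eq_measure_integral.
Qed.

Lemma ae_completed (P : set R) :
  {ae mu, forall t, P t} -> {ae nu, forall t, P t}.
Proof.
by move=> [N [mN N0 PN]]; exists N; split => //; exact: measurable_lebesgueR.
Qed.

End Completion.

(** * Absolute continuity and monotonicity *)

Section AbsoluteContinuity.
Context {R : realType}.

Lemma absolutely_continuousS {X : normedModType R} (a b c d : R)
    (f : R -> X) : a <= c -> d <= b ->
  absolutely_continuous a b f -> absolutely_continuous c d f.
Proof.
move=> ac db acf e e0; have [del del0 H] := acf e e0.
exists del => // n l r lr tr sm; apply: H => // i.
have [cl lri rd] := lr i.
by split => //; [exact: le_trans cl|exact: le_trans db].
Qed.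

Lemma absolutely_continuous_comp {X Y : normedModType R} (C a b : R)
    (f : R -> X) (g : R -> Y) :
  (forall s t, a <= s -> s <= t -> t <= b ->
    `|g t - g s| <= C * `|f t - f s|) ->
  absolutely_continuous a b f -> absolutely_continuous a b g.
Proof.
move=> gf acf e e0.
(* C itself may be zero or negative *)
have C0 : 0 < `|C| + 1 by rewrite ltr_wpDl.
have [del del0 H] := acf (e / (`|C| + 1)) (divr_gt0 e0 C0).
exists del => // n l r lr tr sm; have := H n l r lr tr sm.
rewrite ltr_pdivlMr// => /(le_lt_trans _); apply.
rewrite mulr_suml; apply: ler_sum => i _; have [al lri rb] := lr i.
apply: (le_trans (gf _ _ al (ltW lri) rb)); rewrite mulrC ler_wpM2l//.
by rewrite (le_trans (ler_norm _))// lerDl.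
Qed.

Lemma absolutely_continuous_dist {X : normedModType R} (a b : R) (f : R -> X) :
  absolutely_continuous a b f ->
  forall e, 0 < e -> exists2 d, 0 < d &
    forall s t, a <= s -> s <= t -> t <= b -> t - s < d -> `|f t - f s| < e.
Proof.
move=> acf e e0; have [d d0 H] := acf e e0; exists d => // s t as_ st tb tsd.
have [->|nst] := eqVneq s t; first by rewrite subrr normr0.
have := H 1%N (fun=> s) (fun=> t); rewrite !big_ord1; apply => //.
  by move=> _; split => //; rewrite lt_neqAle nst.
by move=> i j _ _ _; rewrite (ord1 i) (ord1 j).
Qed.

End AbsoluteContinuity.

Section Dini.
Context {R : realType}.
Local Notation mu := (@lebesgue_measure R).

Definition interval_packing (U : set R) (a t : R) {n} (l r : 'I_n -> R) :=
  (forall i, [/\ a <= l i, l i < r i, r i <= t & `]l i, r i[ `<=` U]) /\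
  trivIset setT (fun i => `]l i, r i[%classic).

Definition variation_sums (U : set R) (a : R) (g : R -> R) (t : R) : set R :=
  [set v | exists n (l r : 'I_n -> R), interval_packing U a t l r /\
    v = \sum_(i < n) `|g (r i) - g (l i)|].

Lemma interval_packing_length (U : set R) (a t : R) {n} (l r : 'I_n -> R) :
  open U -> interval_packing U a t l r ->
  ((\sum_(i < n) (r i - l i))%:E <= mu U)%E.
Proof.
move=> oU [lr tr].
have -> : ((\sum_(i < n) (r i - l i))%:E =
    \sum_(i < n) mu (`]l i, r i[%classic : set R))%E.
  rewrite -sumEFin; apply: eq_bigr => i _; have [_ lri _ _] := lr i.
  by rewrite lebesgue_measure_itv/= lte_fin lri.
rewrite -(@measure_bigsetU_ord _ _ _ mu)//.
apply: le_measure; rewrite ?inE.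
- by apply: bigsetU_measurable => i _; exact: measurable_itv.
- exact: open_measurable.
- elim/big_ind: _ => [//|A B AU BU|i _]; first by rewrite subUset.
  by have [] := lr i.
Qed.

(** Appending the interval between s and t to a family that ends before s: this
    is the step by which the supremum of the variation sums absorbs an
    uncontrolled increment of g inside U. *)
Lemma variation_sums_step (U : set R) (a s t : R) (g : R -> R) (v : R) :
  a <= s -> s < t -> `]s, t[ `<=` U ->
  variation_sums U a g s v -> variation_sums U a g t (v + `|g t - g s|).
Proof.
move=> as_ st stU [n [l [r [[lr tr] ->]]]].
pose ext (f : 'I_n -> R) (c : R) (i : 'I_n.+1) :=
  if unlift ord_max i is Some j then f j else c.
have extl f c j : ext f c (widen_ord (leqnSn n) j) = f j.
  rewrite /ext (_ : widen_ord _ j = lift ord_max j) ?liftK//.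
  by apply: val_inj; rewrite /= /bump leqNgt ltn_ord.
have extm f c : ext f c ord_max = c by rewrite /ext unlift_none.
have cases (i : 'I_n.+1) : i = ord_max \/ exists j, i = widen_ord (leqnSn n) j.
  have [j ->|->] := unliftP ord_max i; [right|by left].
  by exists j; apply: val_inj; rewrite /= /bump leqNgt ltn_ord.
exists n.+1, (ext l s), (ext r t); split; last first.
  rewrite big_ord_recr/= !extm; congr (_ + _).
  by apply: eq_bigr => i _; rewrite !extl.
split.
  move=> i; have [->|[j ->]] := cases i; first by rewrite !extm.
  rewrite !extl; have [? ? ? ?] := lr j; split => //.
  exact/(le_trans _ (ltW st)).
apply/trivIsetP => i j _ _.
have disj k : `]l k, r k[ `&` `]s, t[ = set0.
  have [_ _ rs _] := lr k; apply/seteqP; split => // u [] /=.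
  rewrite !in_itv/= => /andP[_ ur] /andP[su _].
  by have := lt_le_trans ur rs; rewrite ltNge (ltW su).
have [->|[i' ->]] := cases i; have [->|[j' ->]] := cases j => ij;
  rewrite ?extm ?extl.
- by rewrite eqxx in ij.
- by rewrite setIC disj.
- by rewrite disj.
- by move/trivIsetP: tr; apply => //; apply: contra_neq ij => ->.
Qed.

(** The exceptional null set is covered by an open set U so small that, by
    absolute continuity, g varies by at most e / 2 along any disjoint intervals
    inside U.  With V t the supremum of that variation before time t, the bound
      g t <= g a + V t + k (t - a)
    propagates from a to b: inside U an increment of g is absorbed by V, and
    outside U by the slope k, which the Dini bound makes available for every
    k > 0. *)
Lemma absolutely_continuous_nonincreasing (a b : R) (g : R -> R) :
  a <= b -> absolutely_continuous a b (g : R -> R^o) ->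
  {ae mu, forall t, a <= t < b -> forall e, 0 < e ->
    \forall h \near 0^'+, g (t + h) <= g t + e * h} ->
  g b <= g a.
Proof.
move=> ab acg [N [mN N0 gN]]; apply/ler_addgt0Pr => e e0.
have e20 : 0 < e / 2 by rewrite divr_gt0.
have [d d0 acgd] := acg _ e20.
have muN : (mu N < +oo)%E by rewrite N0.
have [U [oU NU muU]] := lebesgue_regularity_outer mN muN d0.
have mU : measurable U by exact: open_measurable.
have {}muU : (mu U < d%:E)%E.
  have UN0 : mu (U `&` N) = 0%E.
    apply/eqP; rewrite -measure_le0 -N0 le_measure ?inE//; exact: measurableI.
  have : (mu U <= mu (U `&` N) + mu (U `\` N))%E.
    rewrite -[X in (mu X <= _)%E](setUIDK U N); apply: measureU2.
      exact: measurableI.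
    exact: measurableD.
  by rewrite UN0 add0e => /le_lt_trans; apply.
pose W := variation_sums U a g.
have W0 t : W t 0.
  exists 0%N, (fun=> 0), (fun=> 0); rewrite big_ord0; split => //.
  by split; [case|apply/trivIsetP => -[]].
have Wlt t v : t <= b -> W t v -> v <= e / 2.
  move=> tb [n [l [r [lrU ->]]]]; apply/ltW/acgd; last 2 first.
  - by case: lrU.
  - rewrite -lte_fin (le_lt_trans _ muU)//.
    exact: interval_packing_length lrU.
  by move=> i; have [? ? rt _] := lrU.1 i; split => //; exact: le_trans tb.
have Wsup t : t <= b -> has_sup (W t).
  by move=> tb; split; [exists 0|exists (e / 2) => v; exact: Wlt].
pose V t := sup (W t).
have V_step s t : a <= s -> s < t -> t <= b -> `]s, t[ `<=` U ->
    V s + `|g t - g s| <= V t.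
  move=> as_ st tb stU; rewrite -lerBrDr; apply: ge_sup; first by exists 0.
  move=> v Wv; rewrite lerBrDr; apply: ub_le_sup; first by case: (Wsup t tb).
  exact: variation_sums_step.
have V_mono s t : s <= t -> t <= b -> V s <= V t.
  move=> st tb; apply: ge_sup; first by exists 0.
  move=> v [n [l [r [[lr tr] ->]]]]; apply: ub_le_sup.
    by case: (Wsup t tb).
  exists n, l, r; split => //; split => // i.
  by have [? ? rs ?] := lr i; split => //; exact: le_trans st.
have V0 t : t <= b -> 0 <= V t.
  by move=> tb; apply: ub_le_sup; [case: (Wsup t tb)|].
have Vb : V b <= e / 2 by apply: ge_sup => [|v]; [exists 0|exact: Wlt].
(* the slack added to b - a only keeps k defined when a = b *)
pose k := e / 2 / (b - a + 1).
have ba1 : 0 < b - a + 1 by rewrite ltr_wpDl// subr_ge0.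
have k0 : 0 < k by rewrite divr_gt0.
pose S := [set t | a <= t <= b /\ g t <= g a + V t + k * (t - a)].
have Sa : S a by split; rewrite ?lexx// subrr mulr0 addr0 lerDl V0.
have supS : has_sup S by split; [exists a|exists b => t [/andP[]]].
pose s := sup S.
have as_ : a <= s by apply: ub_le_sup => //; case: supS.
have sb : s <= b by apply: ge_sup; [exists a|move=> t [/andP[]]].
(* S contains its supremum: V is monotone and g is continuous from the left *)
have Ss : S s.
  split; first by rewrite as_.
  apply/ler_addgt0Pr => c c0.
  have [z z0 gz] := absolutely_continuous_dist acg c0.
  have [t St szt] := sup_adherent z0 supS.
  have ts : t <= s by apply: ub_le_sup => //; case: supS.
  have [/andP[at_ tb] gt] := St.
  have := gz t s at_ ts sb.
  rewrite ltrBlDr -ltrBlDl => /(_ szt) /ltr_normlW gst.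
  have Vts : V t <= V s by exact: V_mono.
  have kts : k * (t - a) <= k * (s - a) by rewrite ler_pM2l// lerD2r.
  lra.
(* if s < b, a point of S beyond s contradicts the choice of s *)
have sbE : s = b.
  apply/eqP; rewrite eq_le sb leNgt; apply/negP => sltb.
  have [_ gs] := Ss.
  suff [t [st tb gt]] : exists t, [/\ s < t, t <= b &
      g t <= g s + (V t - V s) + k * (t - s)].
    suff : S t by move/(ub_le_sup supS.2); rewrite leNgt st.
    split; first by rewrite tb (le_trans as_)// ltW.
    lra.
  have [Us|nUs] := pselect (U s).
    have /nbhs_ballP[c /= c0 cU] : nbhs s U by exact: open_nbhs_nbhs.
    pose t := Num.min b (s + c).
    have st : s < t by rewrite lt_min sltb ltrDl.
    have tb : t <= b by rewrite ge_min lexx.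
    exists t; split => //.
    have /(V_step _ _ as_ st tb) : `]s, t[ `<=` U.
      move=> u /=; rewrite in_itv/= lt_min => /and3P[su _ usc]; apply: cU.
      by rewrite /ball/= ler0_norm; lra.
    have := ler_norm (g t - g s).
    have : 0 <= k * (t - s) by rewrite mulr_ge0 ?subr_ge0// ltW.
    lra.
  have dini_s : forall c, 0 < c ->
      \forall h \near 0^'+, g (s + h) <= g s + c * h.
    apply: contrapT => ndini; apply/nUs/NU/gN => /= dini; apply: ndini.
    by apply: dini; rewrite as_.
  have gk := dini_s k k0.
  have [h [h0 hb gh]] :
      exists h, [/\ 0 < h, h <= b - s & g (s + h) <= g s + k * h].
    near (0 : R)^'+ => h; exists h; split => //.
    - by near: h; apply: nbhs_right_le; rewrite subr_gt0.
    - by near: h.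
  exists (s + h); split; [lra|lra|].
  have : V s <= V (s + h) by apply: V_mono; lra.
  by lra.
have [_] := Ss; rewrite sbE => gb.
have kba : k * (b - a) <= e / 2.
  rewrite /k mulrAC ler_pdivrMr// ler_pM2l//; lra.
lra.
Unshelve. all: by end_near.
Qed.
End Dini.

(** * Integrating the slopes of a nonincreasing function *)

Section MonotoneSlopes.
Context {R : realType}.
Local Notation mu := (@lebesgue_measure R).
Local Notation nu := (@completed_lebesgue_measure R).

Lemma continuous_antiderivative (a b : R) (g : R -> R) :
  continuous g -> a < b ->
  exists G : R -> R, forall t, a < t < b -> is_derive t 1 G (g t).
Proof.
move=> cg ab.
have ig : mu.-integrable `[a, b] (EFin \o g).
  by apply: continuous_compact_integrable;
    [exact: segment_compact|exact: continuous_subspaceT].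
exists (fun x => \int[mu]_(t in `[a, x]) g t)%R => t /andP[at_ tb].
have [dG G'] := continuous_FTC1_closed tb ig at_ (cg t).
by rewrite derive1E in G'; exact: DeriveDef dG G'.
Qed.

(** The integral telescopes into the means of g over [a, a + h] and over
    [b, b + h], which monotonicity bounds by g a and g (b + h). *)
Lemma integral_slope_le (a b h : R) (g : R -> R) :
  continuous g -> {homo g : s t / s <= t >-> t <= s} -> a < b -> 0 < h ->
  (\int[mu]_(t in `[a, b]) (h^-1 * (g t - g (t + h)))%:E <=
   (g a - g (b + h))%:E)%E.
Proof.
move=> cg mg ab h0.
(* the unit margins make a, b and b + h interior points *)
have [|G dG] := @continuous_antiderivative (a - 1) (b + h + 1) g cg.
  by lra.
pose F t := h^-1 * (G t - G (t + h)).
have dF t : a - 1 < t < b + 1 -> is_derive t 1 F (h^-1 * (g t - g (t + h))).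
  move=> tab.
  have ? : is_derive t 1 G (g t) by apply: dG; lra.
  have ? : is_derive t 1 (fun t => G (t + h)) (g (t + h)).
    have ? : is_derive (t + h) 1 G (g (t + h)) by apply: dG; lra.
    rewrite -[g _]mulr1; apply: (@is_derive1_comp _ G (shift h)).
    exact: is_derive_shift.
  exact: (is_deriveZ h^-1 (is_deriveB _ _)).
have cF t : a - 1 < t < b + 1 -> {for t, continuous F}.
  move=> tab; apply: differentiable_continuous; apply/derivable1_diffP.
  by case: (dF t tab).
rewrite (@continuous_FTC2 _ _ F)//; last 3 first.
- apply: continuous_subspaceT => t; apply: cvgM; first exact: cvg_cst.
  apply: cvgB; first exact: cg.
  apply: continuous_comp; last exact: cg.
  by apply: cvgD; [exact: cvg_id|exact: cvg_cst].
- split.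
  + move=> t; rewrite in_itv/= => tab; by have [] := dF t; [lra|].
  + apply: cvg_at_right_filter; apply: cF; lra.
  + apply: cvg_at_left_filter; apply: cF; lra.
- move=> t; rewrite in_itv/= => tab; rewrite derive1E.
  by have [] := dF t; [lra|].
rewrite -EFinB lee_fin /F.
have mvt u v : a - 1 < u -> u < v -> v < b + h + 1 ->
  g v * (v - u) <= G v - G u <= g u * (v - u).
  move=> au uv vb.
  have [||c cuv ->] := @MVT _ G g u v uv.
  - by move=> t; rewrite in_itv/= => tuv; apply: dG; lra.
  - apply: derivable_within_continuous => t; rewrite in_itv/= => tuv.
    have ? : is_derive t 1 G (g t) by apply: dG; lra.
    by [].
  move: cuv; rewrite in_itv/= => /andP[uc cv].
  by rewrite !ler_pM2r ?subr_gt0// !mg ?ltW.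
have /andP[_ Ga] :
    g (a + h) * (a + h - a) <= G (a + h) - G a <= g a * (a + h - a).
  by apply: mvt; lra.
have /andP[Gb _] :
    g (b + h) * (b + h - b) <= G (b + h) - G b <= g b * (b + h - b).
  by apply: mvt; lra.
by rewrite -mulrBr ler_pdivrMl//; lra.
Qed.

(** Fatou's lemma for the difference quotients with step 1 / (n + 1): they are
    nonnegative because g decreases, their integrals are bounded by
    [integral_slope_le], and their pointwise limit dominates m. *)
Lemma integral_le_decrease (a b : R) (g m : R -> R) : a < b ->
  continuous g -> {homo g : s t / s <= t >-> t <= s} ->
  lebesgue_measurable_fun `[a, b] m -> (forall t, a <= t <= b -> 0 <= m t) ->
  {ae mu, forall t, a <= t <= b -> exists2 L, m t <= L &
     h^-1 * (g t - g (t + h)) @[h --> 0^'+] --> L} ->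
  (\int[nu]_(t in `[a, b]) (m t)%:E <= (g a - g b)%:E)%E.
Proof.
move=> ab cg mg mm m0 slope.
pose step n : R := n.+1%:R^-1.
have step0 n : 0 < step n by rewrite invr_gt0.
pose q n t : \bar R := ((step n)^-1 * (g t - g (t + step n)))%:E.
have cq n : continuous (fun t => (step n)^-1 * (g t - g (t + step n))).
  move=> t; apply: cvgM; first exact: cvg_cst.
  apply: cvgB; first exact: cg.
  apply: continuous_comp; last exact: cg.
  by apply: cvgD; [exact: cvg_id|exact: cvg_cst].
have q0 n t : (0 <= q n t)%E.
  rewrite lee_fin mulr_ge0 ?invr_ge0 ?(ltW (step0 n))// subr_ge0.
  by rewrite mg// lerDl ltW.
have mDmu : measurable (`[a, b]%classic : set R) by exact: measurable_itv.
have mD : measurable (`[a, b] : set (lebesgueR R)).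
  exact: measurable_itvcc_lebesgueR.
have mq n : measurable_fun `[a, b] (q n).
  apply/measurable_EFinP; apply: measurable_funTS.
  exact: continuous_measurable_fun.
have mq' n : measurable_fun (`[a, b] : set (lebesgueR R)) (q n).
  exact: measurable_fun_lebesgueR.
have lim_q0 t : (0 <= limn_einf (q ^~ t))%E.
  rewrite limn_einf_lim; apply: lime_ge; first exact: is_cvg_einfs.
  by apply: nearW => n; apply: le_ereal_inf_tmp => _ [k _ <-].
apply: (@le_trans _ _ (\int[nu]_(t in `[a, b]) limn_einf (q ^~ t))%E).
  apply: ae_ge0_le_integral.
  - exact: mD.
  - by move=> t; rewrite /= in_itv/= lee_fin => /m0.
  - exact/measurable_EFinP.
  - by move=> t _.
  - apply: measurableT_comp; first exact: oppe_measurable.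
    apply: measurable_fun_limn_esup => n.
    by apply: measurableT_comp; [exact: oppe_measurable|exact: mq'].
  apply: ae_completed; move: slope; apply: filterS.
    exact: (ae_filter_ringOfSetsType mu).
  move=> t tL; rewrite /= in_itv/= => /tL[L mL /cvg_at_rightP cL].
  have qL : q n t @[n --> \oo] --> L%:E.
    apply: cvg_EFin; first exact: nearW.
    by apply: (cL step); split => //; exact: cvg_harmonic.
  by rewrite (cvg_limn_einf_sup qL).1 lee_fin.
apply: (le_trans (fatou _ mD mq' _)); first by move=> n t _.
have gab : (g a - g (b + step n))%:E @[n --> \oo] --> (g a - g b)%:E.
  apply: cvg_EFin; first exact: nearW.
  apply: cvgB; first exact: cvg_cst.
  apply: continuous_cvg; first exact: cg.
  rewrite -[X in _ --> X]addr0; apply: cvgD; first exact: cvg_cst.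
  exact: cvg_harmonic.
rewrite limn_einf_lim -(cvg_lim _ gab)//; apply: lee_lim.
- exact: is_cvg_einfs.
- by apply/cvg_ex; eexists; exact: gab.
apply: nearW => n.
apply: (@le_trans _ _ (\int[nu]_(t in `[a, b]) q n t)%E).
  by apply: ereal_inf_lbound; exists n => /=.
by rewrite ge0_integral_completed//; exact: integral_slope_le.
Qed.

End MonotoneSlopes.

(** * First order behaviour along a nonexpansive vector field *)

Section FirstOrder.
Context {R : realType}.

Lemma is_derive_right_slope {X : normedModType R} (x : R -> X) (t : R) (v : X) :
  is_derive (t : R^o) 1 (x : R^o -> X) v ->
  h^-1 *: (x (t + h) - x t) @[h --> 0^'+] --> v.
Proof.
move=> [dx <-]; apply: (cvg_trans _ (cvg_dnbhs_at_right dx)).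
apply: near_eq_cvg; near=> h.
have -> // : (x \o shift t) h%:A = x (t + h).
by rewrite /= /GRing.scale/= mulr1 addrC.
Unshelve. all: by end_near. Qed.

Lemma is_derive_first_order {X : normedModType R} (x : R -> X) (t : R)
    (v : X) (e : R) :
  is_derive (t : R^o) 1 (x : R^o -> X) v -> 0 < e ->
  \forall h \near 0^'+, `|x (t + h) - (x t + h *: v)| <= e * h.
Proof.
move=> /is_derive_right_slope/cvgrPdist_le dx e0; near=> h.
have h0 : 0 < h by [].
have -> : x (t + h) - (x t + h *: v) = h *: (h^-1 *: (x (t + h) - x t) - v).
  by rewrite scalerBr scalerA mulfV ?gt_eqF// scale1r opprD addrA.
by rewrite normrZ gtr0_norm// mulrC ler_pM2r// distrC; near: h; exact: dx.
Unshelve. all: by end_near. Qed.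

Lemma convex_combE {X : lmodType R} (c : R) (u v : X) :
  (1 - c) *: u + c *: v = u + c *: (v - u).
Proof. by rewrite scalerBl scale1r scalerBr -addrA [- _ + _]addrC. Qed.

Section Nonexpansive.
Context {X : normedModType R} (T : X -> X) (x : R -> X).
Hypothesis hT : nonexpansive T.

(** Up to o(h), x (t + h) - z is a convex combination of x t - z and
    T (x t) - T z, and the latter is no longer than the former. *)
Lemma dist_fixed_point_dini (t l : R) (z : X) : Fix T z -> 0 <= l <= 1 ->
  is_derive (t : R^o) 1 (x : R^o -> X) (l *: (T (x t) - x t)) ->
  forall e, 0 < e ->
    \forall h \near 0^'+, `|x (t + h) - z| <= `|x t - z| + e * h.
Proof.
move=> Tz /andP[l0 l1] dx e e0; near=> h.
have h0 : 0 < h by [].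
have h1 : h <= 1 by near: h; exact: nbhs_right_le.
have : `|x (t + h) - (x t + h *: (l *: (T (x t) - x t)))| <= e * h.
  by near: h; exact: is_derive_first_order.
set w := x t; set r := _ - (w + _) => re.
have xE : x (t + h) = w + (h * l) *: (T w - w) + r.
  by rewrite -scalerA [RHS]addrC subrK.
have -> : x (t + h) - z = (1 - h * l) *: (w - z) + (h * l) *: (T w - T z) + r.
  rewrite xE addrAC; congr (_ + r).
  by rewrite convex_combE Tz opprB [T w - z + _]addrA subrK addrAC.
have hl0 : 0 <= h * l by rewrite mulr_ge0// ltW.
have hl1 : 0 <= 1 - h * l by rewrite subr_ge0 mulr_ile1// ltW.
apply: (le_trans (ler_normD _ _)); apply: lerD => //.
apply: (le_trans (ler_normD _ _)); rewrite !normrZ !ger0_norm//.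
have : h * l * `|T w - T z| <= h * l * `|w - z| by rewrite ler_wpM2l.
lra.
Unshelve. all: by end_near. Qed.

(** Going from x (t + h) to T (x (t + h)) through T (x t) costs the fractions
    1 - h l and, T being nonexpansive, h l of the residual at time t. *)
Lemma residual_dini (t l : R) : 0 <= l <= 1 ->
  is_derive (t : R^o) 1 (x : R^o -> X) (l *: (T (x t) - x t)) ->
  forall e, 0 < e -> \forall h \near 0^'+,
    `|x (t + h) - T (x (t + h))| <= `|x t - T (x t)| + e * h.
Proof.
move=> /andP[l0 l1] dx e e0; near=> h.
have h0 : 0 < h by [].
have h1 : h <= 1 by near: h; exact: nbhs_right_le.
have : `|x (t + h) - (x t + h *: (l *: (T (x t) - x t)))| <= e / 2 * h.
  by near: h; apply: is_derive_first_order => //; rewrite divr_gt0.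
set w := x t; set w' := x (t + h); set r := _ - (w + _) => re.
have xE : w' = w + (h * l) *: (T w - w) + r.
  by rewrite -scalerA [RHS]addrC subrK.
have hl0 : 0 <= h * l by rewrite mulr_ge0// ltW.
have hl1 : 0 <= 1 - h * l by rewrite subr_ge0 mulr_ile1// ltW.
have step : `|w' - w| <= h * l * `|w - T w| + `|r|.
  have -> : w' - w = (h * l) *: (T w - w) + r.
    by rewrite xE addrAC [w + _]addrC addrK.
  by rewrite (le_trans (ler_normD _ _))// normrZ ger0_norm// distrC.
have rest : `|w' - T w| <= (1 - h * l) * `|w - T w| + `|r|.
  have -> : w' - T w = (1 - h * l) *: (w - T w) + r.
    rewrite xE addrAC; congr (_ + r).
    by rewrite scalerBl scale1r -scalerN opprB addrAC.
  by rewrite (le_trans (ler_normD _ _))// normrZ ger0_norm.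
have := ler_distD (T w) w' (T w').
have := hT w w'; rewrite (distrC w w').
lra.
Unshelve. all: by end_near. Qed.
End Nonexpansive.
End FirstOrder.

(** * Trajectories: monotonicity and energy *)

Section Trajectory.
Context {R : realType} {X : completeNormedModType R}.
Local Notation mu := (@lebesgue_measure R).
Local Notation nu := (@completed_lebesgue_measure R).
Variables (T : X -> X) (lambda : R -> R) (x0 : X) (x : R -> X).
Hypothesis hT : nonexpansive T.
Hypothesis lambda01 : forall t, 0 <= t -> 0 <= lambda t <= 1.
Hypothesis hx : strong_global_solution T lambda x0 x.

(** Lipschitz continuity passes the absolute continuity of x on to f \o x, so
    that first order estimates at the points where x solves the equation are all
    that remains to be checked. *)
Lemma trajectory_nonincreasing (C : R) (f : X -> R) :
  (forall u v, `|f u - f v| <= C * `|u - v|) ->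
  (forall t, 0 <= t ->
    is_derive (t : R^o) 1 (x : R^o -> X) (lambda t *: (T (x t) - x t)) ->
    forall e, 0 < e ->
      \forall h \near 0^'+, f (x (t + h)) <= f (x t) + e * h) ->
  forall s t, 0 <= s -> s <= t -> f (x t) <= f (x s).
Proof.
move=> lipf dini s t s0 st; have [_ acx dx] := hx.
apply: (@absolutely_continuous_nonincreasing _ s t (f \o x)) => //.
  apply: (@absolutely_continuous_comp _ _ _ C _ _ x) => [u v _ _ _|].
    exact: lipf.
  apply: (absolutely_continuousS s0 _ (acx (t + 1) _)); first by rewrite lerDl.
  by rewrite ltr_wpDl// (le_trans s0).
move: dx; apply: filterS; first exact: (ae_filter_ringOfSetsType mu).
move=> u du /andP[su _]; have u0 := le_trans s0 su.
exact: dini u0 (du u0).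
Qed.

Lemma dist_fixed_point_nonincreasing (z : X) (s t : R) : Fix T z ->
  0 <= s -> s <= t -> `|x t - z| <= `|x s - z|.
Proof.
move=> Tz; apply: (@trajectory_nonincreasing 1 (fun u => `|u - z|)).
  move=> u v; rewrite mul1r (le_trans (ler_dist_dist _ _))//.
  by rewrite opprB addrA subrK.
by move=> r r0; apply: dist_fixed_point_dini => //; exact: lambda01.
Qed.

Lemma residual_nonincreasing (s t : R) :
  0 <= s -> s <= t -> `|x t - T (x t)| <= `|x s - T (x s)|.
Proof.
apply: (@trajectory_nonincreasing 2 (fun u => `|u - T u|)).
  move=> u v; rewrite (le_trans (ler_dist_dist _ _))//.
  have -> : u - T u - (v - T v) = (u - v) - (T u - T v).
    by rewrite !opprD !opprK addrACA.
  by rewrite (le_trans (ler_normB _ _))//; have := hT u v; lra.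
by move=> r r0; apply: residual_dini => //; exact: lambda01.
Qed.

(** Freezing x before time 0 gives a function that is continuous on the whole
    line, although x is only controlled on [0, +oo[. *)
Lemma trajectory_continuous : continuous (fun t : R => x (Num.max 0 t)).
Proof.
move=> t; apply/cvgrPdist_lt => e e0; have [_ acx _] := hx.
set t' := Num.max 0 t.
have t'0 : 0 <= t' by rewrite le_max lexx.
have t1 : 0 < t' + 1 by rewrite ltr_wpDl.
have [d d0 xd] := absolutely_continuous_dist (acx _ t1) e0.
near=> s.
have st : `|t - s| < d by near: s; apply: cvgr_dist_lt => //; exact: cvg_id.
have st1 : `|t - s| < 1 by near: s; apply: cvgr_dist_lt => //; exact: cvg_id.
set s' := Num.max 0 s.
have s'0 : 0 <= s' by rewrite le_max lexx.
have ts' : `|t' - s'| <= `|t - s|.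
  rewrite /t' /s' /Num.max.
  have := ler_norm (t - s); have := ler_norm (s - t); rewrite (distrC s).
  by do 2 case: ltP => ?; rewrite ler_norml; lra.
have [le_st|/ltW le_ts] := leP s' t'.
  have := le_trans (ler_norm _) ts'.
  by move=> ?; apply: xd => //; lra.
rewrite distrC; rewrite distrC in ts'.
have := le_trans (ler_norm _) ts'.
by move=> ?; apply: xd => //; lra.
Unshelve. all: by end_near. Qed.

Variable ip : {dot X for (idfun : R -> R)}.
Hypothesis hip : induces_norm ip.

Lemma normD_sqr (u v : X) : `|u + v| ^+ 2 = `|u| ^+ 2 + `|v| ^+ 2 + 2 * ip u v.
Proof. by rewrite !hip hnormD expr0 mul1r /=; lra. Qed.

Lemma ipZr (u v : X) (c : R) : ip u (c *: v) = c * ip u v.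
Proof. by rewrite linearZr_LR. Qed.

Lemma sqr_dist_slope (t : R) (y : X) (v : X) :
  is_derive (t : R^o) 1 (x : R^o -> X) v ->
  h^-1 * (`|x t - y| ^+ 2 - `|x (t + h) - y| ^+ 2) @[h --> 0^'+] -->
  - (2 * ip (x t - y) v).
Proof.
move=> /is_derive_right_slope dx.
set w := x t - y.
(* polarization: only the norm is known to be continuous; the vanishing term
   is the limit of the second order remainder *)
have -> : 2 * ip w v = `|w + v| ^+ 2 - `|w| ^+ 2 - `|v| ^+ 2 + 0 * `|v| ^+ 2.
  by rewrite normD_sqr; lra.
pose D h := h^-1 *: (x (t + h) - x t).
have : - (`|w + D h| ^+ 2 - `|w| ^+ 2 - `|D h| ^+ 2 + h * `|D h| ^+ 2)
    @[h --> 0^'+] -->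
  - (`|w + v| ^+ 2 - `|w| ^+ 2 - `|v| ^+ 2 + 0 * `|v| ^+ 2).
  have sqr_cvg (f : R -> X) l : f h @[h --> 0^'+] --> l ->
      `|f h| ^+ 2 @[h --> 0^'+] --> `|l| ^+ 2.
    move=> fl; rewrite expr2; under eq_fun do rewrite expr2.
    by apply: cvgM; exact: cvg_norm.
  have wD : `|w + D h| ^+ 2 @[h --> 0^'+] --> `|w + v| ^+ 2.
    by apply: sqr_cvg; apply: cvgD => //; exact: cvg_cst.
  apply: cvgN; apply: cvgD; last first.
    apply: cvgM; last exact: sqr_cvg.
    by apply: cvg_at_right_filter; exact: cvg_id.
  by apply: cvgB; [apply: cvgB => //; exact: cvg_cst|exact: sqr_cvg].
apply: cvg_trans; apply: near_eq_cvg; near=> h.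
have h0 : 0 < h by [].
have -> : x (t + h) - y = w + h *: D h.
  by rewrite /D scalerA mulfV ?gt_eqF// scale1r /w [RHS]addrC addrA subrK.
move: (w) (D h) => u d; rewrite !normD_sqr ipZr normrZ exprMn gtr0_norm//.
by field; rewrite gt_eqF.
Unshelve. all: by end_near. Qed.

(** Expand the square in |(w - y) + (T w - w)| = |T w - T y| <= |w - y|. *)
Lemma residual_sqr_le (w y : X) : Fix T y ->
  `|w - T w| ^+ 2 <= - (2 * ip (w - y) (T w - w)).
Proof.
move=> Ty; have := normD_sqr (w - y) (T w - w).
have -> : w - y + (T w - w) = T w - y by rewrite addrC addrA subrK.
have : `|T w - y| ^+ 2 <= `|w - y| ^+ 2.
  by rewrite ler_sqr ?nnegrE// -{1}Ty hT.
by rewrite (distrC w (T w)); lra.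
Qed.

Hypothesis lambda_meas : lebesgue_measurable_fun `[0, +oo[ lambda.

(** |x - y|^2 decreases at rate at least lambda |x - T x|^2, and it can decrease
    by no more than its initial value. *)
Lemma residual_energy (y : X) (a c : R) : Fix T y -> 0 < a -> 0 <= c ->
  (forall t, 0 <= t <= a -> c <= `|x t - T (x t)|) ->
  ((c ^+ 2)%:E * \int[nu]_(t in `[0%R, a]) (lambda t)%:E <=
   (`|x0 - y| ^+ 2)%:E)%E.
Proof.
move=> Ty a0 c0 cle; have [x00 acx dx] := hx.
pose g t := `|x (Num.max 0 t) - y| ^+ 2.
have mD := @measurable_itvcc_lebesgueR _ 0 a.
have ml := lebesgue_measurable_fun_itv (a := a) lambda_meas.
rewrite -ge0_integralZl_EFin; last 4 first.
- exact: mD.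
- by move=> t; rewrite /= in_itv/= lee_fin => /andP[/lambda01/andP[]].
- exact/measurable_EFinP.
- exact: sqr_ge0.
under eq_integral do rewrite -EFinM.
apply: (@le_trans _ _ (g 0 - g a)%:E); last first.
  by rewrite lee_fin /g maxxx x00 gerBl sqr_ge0.
apply: integral_le_decrease => //.
- move=> t.
  have ct : `|x (Num.max 0 s) - y| @[s --> t] --> `|x (Num.max 0 t) - y|.
    apply: cvg_norm; apply: cvgB; last exact: cvg_cst.
    exact: trajectory_continuous.
  exact: (cvgM ct ct).
- move=> s t st; rewrite /g ler_sqr ?nnegrE//.
  apply: dist_fixed_point_nonincreasing => //; first by rewrite le_max lexx.
  by rewrite ge_max !le_max lexx st orbT.
- apply: measurable_funM => //; exact: measurable_cst.
- move=> t /andP[t0 _]; rewrite mulr_ge0 ?sqr_ge0//.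
  by have /andP[] := lambda01 t0.
move: dx; apply: filterS; first exact: (ae_filter_ringOfSetsType mu).
move=> t dt /andP[t0 ta]; have {}dt := dt t0.
exists (- (2 * ip (x t - y) (lambda t *: (T (x t) - x t)))).
  have /andP[l0 l1] := lambda01 t0.
  rewrite ipZr mulrCA -mulrN mulrC ler_wpM2l//.
  apply: le_trans (residual_sqr_le _ Ty).
  by rewrite ler_sqr ?nnegrE// cle// t0.
apply: (cvg_trans _ (sqr_dist_slope (y := y) dt)).
apply: near_eq_cvg; near=> h.
have h0 : 0 < h by [].
by rewrite /g !max_r// addr_ge0// ltW.
Unshelve. all: by end_near. Qed.

Lemma residual_rate (y : X) (a B e : R) : Fix T y -> `|x0 - y| <= B ->
  0 < B -> 0 < e -> 0 < a ->
  ((B ^+ 2 / e ^+ 2)%:E <= \int[nu]_(t in `[0%R, a]) (lambda t)%:E)%E ->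
  `|x a - T (x a)| <= e.
Proof.
move=> Ty x0B B0 e0 a0 Ble; set c := `|x a - T (x a)|.
have c0 : 0 <= c by exact: normr_ge0.
have cmin t : 0 <= t <= a -> c <= `|x t - T (x t)|.
  by move=> /andP[t0 ta]; exact: residual_nonincreasing.
have := residual_energy Ty a0 c0 cmin.
move=> /(le_trans (lee_wpmul2l _ Ble)); rewrite !lee_fin sqr_ge0 => /(_ isT) cB.
have xB : `|x0 - y| ^+ 2 <= B ^+ 2 by rewrite ler_sqr ?nnegrE// ltW.
have := le_trans cB xB.
rewrite mulrCA ger_pMr ?exprn_gt0// ler_pdivrMr ?exprn_gt0// mul1r.
by rewrite ler_sqr// nnegrE ltW.
Qed.

End Trajectory.

(** * Zeros of the residual and lower bounds for the integral of lambda *)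

Section Distance.
Context {R : realType} {X : normedModType R}.

Lemma edist_inf_lt (A : set X) (u : X) (e : R) :
  (edist_inf A u < e%:E)%E -> exists2 z, A z & `|u - z| < e.
Proof.
move=> /ereal_inf_lt[_ [z Az <-]] /edist_lt_ball; rewrite -ball_normE => uz.
by exists z.
Qed.

Lemma edist_inf_subset (A B : set X) (u : X) :
  A `<=` B -> (edist_inf B u <= edist_inf A u)%E.
Proof. by move=> AB; apply: ereal_inf_le_tmp; exact: image_subset. Qed.

Lemma zer_residual (T : X -> X) (y : X) (b : R) :
  zer (residual T y b) `<=` Fix T.
Proof.
move=> z; rewrite /zer /residual /=; case: ifP => // _ [] /eqP.
by rewrite normr_eq0 subr_eq0 => /eqP.
Qed.
End Distance.

Section WeightIntegral.
Context {R : realType}.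
Local Notation nu := (@completed_lebesgue_measure R).
Variable lambda : R -> R.
Hypothesis lambda_meas : lebesgue_measurable_fun `[0, +oo[ lambda.
Hypothesis lambda01 : forall t, 0 <= t -> 0 <= lambda t <= 1.

Lemma integral_weight_le (a : R) :
  (\int[nu]_(t in `[0%R, a]) (lambda t * (1 - lambda t))%:E <=
   \int[nu]_(t in `[0%R, a]) (lambda t)%:E)%E.
Proof.
have mD := @measurable_itvcc_lebesgueR R 0 a.
have ml := lebesgue_measurable_fun_itv (a := a) lambda_meas.
apply: ge0_le_integral.
- exact: mD.
- move=> t; rewrite /= in_itv/= lee_fin => /andP[/lambda01/andP[l0 l1] _].
  by rewrite mulr_ge0// subr_ge0.
- apply/measurable_EFinP; apply: measurable_funM; first exact: ml.
  by apply: measurable_funB; [exact: measurable_cst|exact: ml].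
- exact/measurable_EFinP.
- move=> t; rewrite /= in_itv/= lee_fin => /andP[/lambda01/andP[l0 l1] _].
  by rewrite ler_piMr// gerBl.
Qed.

Lemma integral_lower_bound (a l : R) : 0 <= a -> 0 <= l ->
  (forall t, 0 <= t -> l <= lambda t) ->
  ((l * a)%:E <= \int[nu]_(t in `[0%R, a]) (lambda t)%:E)%E.
Proof.
move=> a0 l0 lle.
have mD := @measurable_itvcc_lebesgueR R 0 a.
have ml := lebesgue_measurable_fun_itv (a := a) lambda_meas.
have -> : ((l * a)%:E = \int[nu]_(t in `[0%R, a]) (cst l%:E) t)%E.
  rewrite integral_cst; last exact: mD.
  rewrite EFinM; congr (_ * _)%E; apply/esym.
  have muE : lebesgue_measure (`[0, a]%classic : set R) = a%:E.
    rewrite lebesgue_measure_itv/= lte_fin sube0.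
    by move: a0; rewrite le_eqVlt => /predU1P[<-|-> //]; rewrite ltxx.
  exact: muE.
apply: ge0_le_integral.
- exact: mD.
- by move=> t _; rewrite lee_fin.
- exact: measurable_cst.
- exact/measurable_EFinP.
- by move=> t; rewrite /= in_itv/= lee_fin => /andP[/lle].
Qed.
End WeightIntegral.

(** * Rates of convergence *)

Unset Implicit Arguments.

Theorem theorem4p7 (R : realType) (X : completeNormedModType R)
  (ip : {dot X for (idfun : R -> R)}) (hip : induces_norm ip)
  (T : X -> X) (hT : nonexpansive T)
  (x0 y : X) (hy : Fix T y)
  (b : nat) (hb : (1 <= b)%N) (hx0 : `|x0 - y| <= b%:R)
  (tau : R -> R)
  (htau : modulus_of_regularity (residual T y b%:R) y b%:R tau)
  (lambda : R -> R)
  (lambda_meas : lebesgue_measurable_fun `[0, +oo[ lambda)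
  (lambda01 : forall t, 0 <= t -> 0 <= lambda t <= 1)
  (x : R -> X) (hx : strong_global_solution T lambda x0 x)
  (phi : R -> R)
  (hphi :
    (exists eta : R -> nat,
      [/\ (\int[@completed_lebesgue_measure R]_(t in `[0%R, +oo[)
             (lambda t * (1 - lambda t))%:E = +oo)%E,
          divergence_modulus (fun t => lambda t * (1 - lambda t)) eta &
          forall eps, 0 < eps ->
            phi eps = (eta (b%:R ^+ 2 / eps ^+ 2))%:R])
    \/
    (exists lambda_ : R,
      [/\ 0 < lambda_,
          (forall t, 0 <= t -> lambda_ <= lambda t) &
          forall eps, 0 < eps ->
            phi eps = 4 * b%:R ^+ 4 / (lambda_ ^+ 2 * eps ^+ 2)])) :
  let rho := fun eps : R => phi (tau eps / 2) + 1 in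
  [/\ (forall eps t : R, 0 < eps -> rho eps <= t ->
         (edist_inf (Fix T) (x t) < eps%:E)%E),
      (forall eps s t : R, 0 < eps -> rho (eps / 2) <= s ->
         rho (eps / 2) <= t -> `|x t - x s| < eps) &
      exists xs : X,
        [/\ Fix T xs,
            x t @[t --> +oo] --> xs &
            forall eps t : R, 0 < eps -> rho (eps / 2) <= t ->
              `|x t - xs| <= eps]].
Proof.
move=> rho.
have [x00 _ _] := hx.
have b0 : 0 < b%:R :> R by rewrite ltr0n.
have [tau0 tauP] := htau.
have b2_gt0 e : 0 < e -> 0 < b%:R ^+ 2 / e ^+ 2 :> R.
  by move=> e0; rewrite divr_gt0 ?exprn_gt0.
have phi0 e : 0 < e -> 0 <= phi e.
  move=> e0; case: hphi => [[eta [_ _ ->//]]|[l [l0 _ ->//]]].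
  by rewrite divr_ge0 ?mulr_ge0 ?exprn_ge0// ltW.
have residual_le e t : 0 < e -> phi e + 1 <= t -> `|x t - T (x t)| <= e.
  move=> e0 et; have := phi0 e e0 => phie.
  (* the additive 1 in rho provides a time interval of positive length *)
  have t0 : 0 < t by lra.
  apply: (residual_rate hT lambda01 hx hip lambda_meas hy hx0) => //.
  case: hphi => [[eta [_ [etaP _] phiE]]|[l [l0 lle phiE]]];
    rewrite phiE// in et.
    apply: (le_trans _ (integral_weight_le lambda_meas lambda01 t)).
    by apply: etaP; [exact: b2_gt0|lra].
  apply: (le_trans _ (integral_lower_bound lambda_meas (ltW t0) (ltW l0) lle)).
  rewrite lee_fin.
  have l1 : l <= 1.
    by have /andP[_] := lambda01 0 (lexx 0); apply: le_trans (lle 0 _).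
  have b1 : 1 <= b%:R :> R by rewrite ler1n.
  have : 4 * b%:R ^+ 4 / (l ^+ 2 * e ^+ 2) <= t by lra.
  rewrite !ler_pdivrMr ?mulr_gt0 ?exprn_gt0// => tle.
  have lb : l * (b%:R ^+ 2) <= 4 * b%:R ^+ 4.
    have b21 : 1 <= b%:R ^+ 2 :> R by rewrite exprn_ege1.
    by rewrite (exprM _ 2 2); nra.
  rewrite -(ler_pM2l l0); apply: (le_trans lb); apply: (le_trans tle).
  by rewrite le_eqVlt; apply/orP; left; apply/eqP; ring.
have rho1 e : 0 < e -> 1 <= rho e.
  by move=> e0; rewrite /rho lerDr phi0// divr_gt0// tau0.
have near_fixed e t : 0 < e -> rho e <= t ->
    (edist_inf (zer (residual T y b%:R)) (x t) < e%:E)%E.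
  move=> e0 et; have tau2 : 0 < tau e / 2 by rewrite divr_gt0// tau0.
  have t0 : 0 <= t by have := rho1 _ e0; lra.
  have xb : `|x t - y| <= b%:R.
    apply: le_trans hx0; rewrite -x00.
    exact: (dist_fixed_point_nonincreasing hT lambda01 hx).
  apply: tauP => //; first by rewrite /closed_ball_/= distrC.
  rewrite /residual xb lte_fin.
  by have := residual_le _ _ tau2 et; have := tau0 _ e0; lra.
have near_fixed_point e t : 0 < e -> rho e <= t ->
    exists2 z, Fix T z & `|x t - z| < e.
  move=> e0 /(near_fixed _ _ e0)/edist_inf_lt[z /zer_residual Tz xz].
  by exists z.
have cauchy e s t : 0 < e -> rho (e / 2) <= s -> rho (e / 2) <= t ->
    `|x t - x s| < e.
  move=> e0 es et; have e2 : 0 < e / 2 by rewrite divr_gt0.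
  (* one fixed point serves all later times *)
  have [z Tz xz] := near_fixed_point _ _ e2 (lexx _).
  have r0 : 0 <= rho (e / 2) by have := rho1 _ e2; lra.
  have := dist_fixed_point_nonincreasing hT lambda01 hx Tz r0 es.
  have := dist_fixed_point_nonincreasing hT lambda01 hx Tz r0 et.
  have := ler_distD z (x t) (x s); rewrite (distrC z).
  lra.
split => //.
  move=> e t e0 et; apply: le_lt_trans (near_fixed _ _ e0 et).
  exact/edist_inf_subset/zer_residual.
have : cvg (x t @[t --> +oo]).
  apply: cauchy_cvg; apply: cauchy_exP => e e0; exists (x (rho (e / 2))).
  suff : \forall t \near +oo, ball (x (rho (e / 2))) e (x t) by [].
  near=> t; rewrite -ball_normE; exact: cauchy.
move=> /cvg_ex[xs xxs]; exists xs.
have xs_close e : 0 < e -> \forall s \near +oo, `|xs - x s| < e.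
  by move=> e0; move/cvgrPdist_lt: xxs; apply.
split => //.
- (* tau may stay away from 0, so that xs is fixed follows not from the
     residual bound but from fixed points accumulating at xs *)
  apply/eqP; rewrite -subr_eq0 -normr_le0; apply/ler_addgt0Pr => e e0.
  have e4 : 0 < e / 4 by rewrite divr_gt0.
  near +oo_R => s.
  have [|z Tz xz] := near_fixed_point (e / 4) s e4.
    by near: s; apply: nbhs_pinfty_ge; exact: num_real.
  have xss : `|xs - x s| < e / 4 by near: s; exact: xs_close.
  have : `|T xs - z| <= `|xs - z| by rewrite -{1}Tz; exact: hT.
  have := ler_distD z (T xs) xs; rewrite (distrC z).
  have := ler_distD (x s) xs z.
  lra.
- move=> e t e0 et; apply/ler_addgt0Pr => d d0.
  near +oo_R => s.
  have : `|xs - x s| < d by near: s; exact: xs_close.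
  have : `|x t - x s| < e.
    by apply: cauchy => //; near: s; apply: nbhs_pinfty_ge; exact: num_real.
  have := ler_distD (x s) (x t) xs; rewrite (distrC (x s)).
  lra.
Unshelve. all: by end_near. Qed.
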